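(* Let $\mathbb{H}_3$ be equipped with a Riemannian $\mathbb{Z}_2^2$-symmetric structure, that is, an injective homomorphism $\rho:\mathbb{Z}_2^2\to \mathrm{Aut}(\mathbb{H}_3)$ defining a $\mathbb{Z}_2^2$-symmetric structure on $\mathbb{H}_3$, together with a left-invariant Riemannian metric on $\mathbb{H}_3$ for which every symmetry $\rho(\gamma)$, $\gamma\in\mathbb{Z}_2^2$, is an isometry. Then this structure is isometric to the Riemannian structure associated with the grading $$\mathfrak{h}_3=\{0\}\oplus\mathbb{R}X_1\oplus\mathbb{R}X_2\oplus\mathbb{R}X_3,$$ with the Riemannian metric written $$g=\omega_1^2+\omega_2^2+\lambda^2\omega_3^2$$ for some real $\lambda\neq 0$.
   Context: $\mathbb{H}_3$ is the Heisenberg group of real matrices $\begin{pmatrix}1&a&c\\0&1&b\\0&0&1\end{pmatrix}$. Its Lie algebra $\mathfrak{h}_3$ has basis $X_1,X_2,X_3$ with $[X_1,X_2]=X_3$, $[X_1,X_3]=[X_2,X_3]=0$; $\{\omega_1,\omega_2,\omega_3\}$ denotes the dual basis, whose elements are also viewed as left-invariant 1-forms on $\mathbb{H}_3$. For a finite abelian group $\Gamma$, a $\Gamma$-symmetric space is a homogeneous space $G/H$ with an injective homomorphism $\rho:\Gamma\to\mathrm{Aut}(G)$ such that $G^\Gamma_e\subset H\subset G^\Gamma$, where $G^\Gamma=\{x\in G:\rho(\gamma)(x)=x\ \forall\gamma\in\Gamma\}$ and $G^\Gamma_e$ is its identity component. The induced action on the Lie algebra gives a $\Gamma$-grading $\mathfrak{g}=\bigoplus_{\gamma\in\Gamma}\mathfrak{g}_\gamma$,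 $[\mathfrak{g}_\gamma,\mathfrak{g}_{\gamma'}]\subset\mathfrak{g}_{\gamma\gamma'}$, with $\mathfrak{g}_e$ the Lie algebra of $H$. The $\rho(\gamma)$ are called the symmetries. For a $\mathbb{Z}_2^2$-symmetric structure on $\mathbb{H}_3$ itself, $G=\mathbb{H}_3$, $H$ is trivial and the identity component of the grading is $\{0\}$; the three other components are the common eigenspaces of the automorphisms of $\mathfrak{h}_3$ induced by the symmetries. A $\Gamma$-symmetric space $G/H$ is Riemannian $\Gamma$-symmetric if it carries a $G$-invariant Riemannian metric for which all symmetries are isometries; in the case of $\mathbb{H}_3$ this is a left-invariant metric whose associated inner product $B$ on $\mathfrak{h}_3$ makes the components of the grading pairwise orthogonal. *)

(* Defs.v *)
From HB Require Import structures.
From mathcomp Require Import all_boot all_order all_algebra.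
From mathcomp Require Import all_classical all_reals all_analysis.

Set Implicit Arguments.
Unset Strict Implicit.
Unset Printing Implicit Defensive.

Import Order.TTheory GRing.Theory Num.Theory.
Import numFieldNormedType.Exports.

Local Open Scope classical_set_scope.
Local Open Scope ring_scope.

(* C^k maps, for finite-dimensional V only: there f is C^(k+1) iff it is
   differentiable and all its directional derivatives are C^k. *)
Fixpoint Ck (R : realType) (V W : normedModType R) (k : nat) (f : V -> W)
    : Prop :=
  match k with
  | 0 => continuous f
  | k'.+1 => (forall x, differentiable f x) /\
             (forall v : V, Ck k' (fun x => 'd f x v))
  end.

Definition smooth (R : realType) (V W : normedModType R) (f : V -> W) : Prop :=
  forall k, Ck k f.

Definition diffeomorphism (R : realType) (V W : normedModType R) (f : V -> W)
    : Prop :=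
  exists g : W -> V, [/\ cancel f g, cancel g f, smooth f & smooth g].

(* The Heisenberg group, seen through the global chart
     (a, b, c)  |->  [1 a c; 0 1 b; 0 0 1].
   Being an open chart of the whole group, it also identifies every tangent
   space with 'rV[R]_3, so that 'd f x is the tangent map of f at x. *)
Definition H3 (R : realType) := 'rV[R]_3.

Notation idx1 := (@Ordinal 3 0 isT).
Notation idx2 := (@Ordinal 3 1 isT).
Notation idx3 := (@Ordinal 3 2 isT).

Definition hmx (R : realType) (x : H3 R) : 'M[R]_3 :=
  1%:M + x 0 idx1 *: delta_mx idx1 idx2
       + x 0 idx2 *: delta_mx idx2 idx3
       + x 0 idx3 *: delta_mx idx1 idx3.

Definition hcoord (R : realType) (A : 'M[R]_3) : H3 R :=
  \row_(k < 3) [:: A idx1 idx2; A idx2 idx3; A idx1 idx3]`_k.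

Definition hone (R : realType) : H3 R := hcoord 1%:M.
Definition hmul (R : realType) (x y : H3 R) : H3 R := hcoord (hmx x *m hmx y).
Definition hinv (R : realType) (x : H3 R) : H3 R := hcoord (invmx (hmx x)).

(* [basisX R idx1], [basisX R idx2], [basisX R idx3] are X_1, X_2, X_3: the tangent
   vectors at the identity along a, b and c, that is the matrices E_12, E_23
   and E_13 (see [bracket_X] below). *)
Definition basisX (R : realType) (i : 'I_3) : 'rV[R]_3 := delta_mx 0 i.

(* The left-invariant 1-form on H3 whose value at the identity is the
   coordinate form dual to X_i. *)
Definition omega (R : realType) (i : 'I_3) (x : H3 R) (v : 'rV[R]_3) : R :=
  ('d (hmul (hinv x) : 'rV[R]_3 -> 'rV[R]_3) x v) 0 i.

(* Automorphisms of H3 as a Lie group. *)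
Definition lie_automorphism (R : realType) (f : H3 R -> H3 R) : Prop :=
  (forall x y, f (hmul x y) = hmul (f x) (f y)) /\
  diffeomorphism (f : 'rV[R]_3 -> 'rV[R]_3).

(* A field of bilinear forms on the tangent spaces of H3: [g x v w] is the
   value at x on the tangent vectors v and w. *)
Definition tensor2 (R : realType) := H3 R -> 'rV[R]_3 -> 'rV[R]_3 -> R.

Definition riemannian_metric (R : realType) (g : tensor2 R) : Prop :=
  [/\ forall x v1 v2 w (a : R), g x (a *: v1 + v2) w = a * g x v1 w + g x v2 w,
      forall x v w, g x v w = g x w v,
      forall x v, v != 0 -> 0 < g x v v
    & forall v w, smooth ((fun x => g x v w) : 'rV[R]_3 -> R^o)].

(* f pulls h back to g. *)
Definition pulls_back (R : realType) (f : H3 R -> H3 R) (h g : tensor2 R)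
    : Prop :=
  forall x v w, let df := 'd (f : 'rV[R]_3 -> 'rV[R]_3) x in
    h (f x) (df v) (df w) = g x v w.

Definition isometry (R : realType) (g h : tensor2 R) (f : H3 R -> H3 R)
    : Prop :=
  diffeomorphism (f : 'rV[R]_3 -> 'rV[R]_3) /\ pulls_back f h g.

Definition left_invariant (R : realType) (g : tensor2 R) : Prop :=
  forall a, pulls_back (hmul a) g g.

(* omega_1^2 + omega_2^2 + lambda^2 omega_3^2, where omega^2 stands for the
   symmetric product (v, w) |-> omega(v) omega(w). *)
Definition standard_metric (R : realType) (lambda : R) : tensor2 R :=
  fun x v w => omega idx1 x v * omega idx1 x w
             + omega idx2 x v * omega idx2 x w
             + lambda ^+ 2 * (omega idx3 x v * omega idx3 x w).

(* Z_2^2, written additively. *)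
Notation Gamma := ('Z_2 * 'Z_2)%type.

Definition fixed_set (R : realType) (rho : Gamma -> H3 R -> H3 R)
    : set 'rV[R]_3 :=
  [set x | forall gamma, rho gamma x = x].

(* rho makes H3 = H3 / H, with H = {1}, a Z_2^2-symmetric space. *)
Definition Z22_symmetric (R : realType) (rho : Gamma -> H3 R -> H3 R) : Prop :=
  let H : set 'rV[R]_3 := [set hone R] in
  [/\ forall gamma, lie_automorphism (rho gamma),
      forall gamma delta, rho (gamma + delta) = rho gamma \o rho delta,
      injective rho,
      connected_component (fixed_set rho) (hone R) `<=` H
    & H `<=` fixed_set rho].

Definition riemannian_Z22_symmetric (R : realType)
    (rho : Gamma -> H3 R -> H3 R) (g : tensor2 R) : Prop :=
  [/\ Z22_symmetric rho, riemannian_metric g, left_invariant g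
    & forall gamma, isometry g g (rho gamma)].

(* The component of degree delta of the grading of h_3 induced by rho. The
   components are the common eigenspaces of the tangent maps at the identity,
   hence indexed by the characters of Z_2^2; delta stands for the character
   gamma |-> (-1)^(delta . gamma). *)
Definition component (R : realType) (rho : Gamma -> H3 R -> H3 R)
    (delta : Gamma) : set 'rV[R]_3 :=
  [set v | forall gamma : Gamma,
    'd (rho gamma : 'rV[R]_3 -> 'rV[R]_3) (hone R) v =
    (-1) ^+ (delta.1 * gamma.1 + delta.2 * gamma.2)%N *: v].

(* The grading induced by rho is {0} + R X_1 + R X_2 + R X_3, the first summand
   being the component of the neutral element. The labelling of the three
   others is free; as deg X_3 = deg X_1 + deg X_2, it amounts to the choice of
   two distinct nontrivial degrees. *)
Definition standard_grading (R : realType) (rho : Gamma -> H3 R -> H3 R)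
    : Prop :=
  let line i : set 'rV[R]_3 := range (fun t : R => t *: basisX R i) in
  component rho 0 = [set 0] /\
  exists d1 d2 : Gamma,
    [/\ [/\ d1 != 0, d2 != 0 & d1 != d2],
        component rho d1 = line idx1,
        component rho d2 = line idx2
      & component rho (d1 + d2) = line idx3].

(* Isometry between two Riemannian Z_2^2-symmetric structures on H3: a Lie
   group automorphism which is an isometry and carries the symmetries of the
   first structure to those of the second. *)
Definition isometric_structures (R : realType)
    (rho : Gamma -> H3 R -> H3 R) (g : tensor2 R)
    (rho' : Gamma -> H3 R -> H3 R) (g' : tensor2 R) : Prop :=
  exists phi : H3 R -> H3 R,
    [/\ lie_automorphism phi, isometry g g' phi
      & forall gamma, phi \o rho gamma = rho' gamma \o phi].

Lemma ord3P (P : 'I_3 -> Prop) : P idx1 -> P idx2 -> P idx3 -> forall i, P i.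
Proof.
move=> P0 P1 P2 [[|[|[|//]]] Hi]; by rewrite (bool_irrelevance Hi isT).
Qed.

Lemma sum3E (R : realType) (F : 'I_3 -> R) : \sum_i F i = F idx1 + F idx2 + F idx3.
Proof.
rewrite !big_ord_recl big_ord0 addr0 addrA.
by congr (F _ + F _ + F _); apply: val_inj.
Qed.

Lemma hcoordK (R : realType) (A : 'M[R]_3) :
  (forall i, A i i = 1) -> (forall i j : 'I_3, (j < i)%N -> A i j = 0) ->
  hmx (hcoord A) = A.
Proof.
move=> A1 A0; apply/matrixP; elim/ord3P; elim/ord3P;
  by rewrite !mxE /= ?mulr1 ?mulr0 ?addr0 ?add0r ?A1 //= [RHS]A0.
Qed.

Lemma hmxK (R : realType) (x : H3 R) : hcoord (hmx x) = x.
Proof.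
by apply/rowP; elim/ord3P; rewrite !mxE /= ?mulr1 ?mulr0 ?addr0 ?add0r.
Qed.

Lemma hmx_mul (R : realType) (x y : H3 R) : hmx (hmul x y) = hmx x *m hmx y.
Proof.
apply: hcoordK.
  by elim/ord3P; rewrite !mxE sum3E !mxE /=
    ?(mulr1, mulr0, addr0, add0r, mul0r, mul1r).
by elim/ord3P; elim/ord3P => // _; rewrite !mxE sum3E !mxE /=
  ?(mulr1, mulr0, addr0, add0r, mul0r, mul1r).
Qed.

Lemma hmx_basisX (R : realType) (i : 'I_3) :
  hmx (basisX R i) - 1%:M =
    [:: delta_mx idx1 idx2; delta_mx idx2 idx3; delta_mx idx1 idx3]`_i.
Proof.
rewrite /hmx !mxE /=; elim/ord3P: i => /=;
  by rewrite ?scale0r ?scale1r ?addr0 addrC addKr.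
Qed.

Lemma bracket_X (R : realType) :
  let N i := hmx (basisX R i) - 1%:M in
  let br A B : 'M[R]_3 := A *m B - B *m A in
  [/\ br (N idx1) (N idx2) = N idx3, br (N idx1) (N idx3) = 0 & br (N idx2) (N idx3) = 0].
Proof.
rewrite /= !hmx_basisX /= !mul_delta_mx_cond.
by split; rewrite /= ?mulr1n ?mulr0n subr0.
Qed.

(* Main.v *)
(* In exponential coordinates every Lie automorphism f of H3 is linear: f
   commutes with powers, so F = log o f o exp satisfies F(n v) = n F(v), and
   differentiability at 0 forces F = dF_0. The symmetries thus become commuting
   linear involutions of h_3 preserving the bracket and the inner product, and
   connectedness of the lines exp(R v) shows that they have no nonzero common
   fixed vector. Decomposing X_1 and X_2 into isotypic parts, [X_1, X_2] <> 0
   yields homogeneous unit vectors Y_1, Y_2 with Y_3 = [Y_1, Y_2] <> 0; their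
   degrees d1, d2, d1 + d2 are nonzero, hence distinct, so the Y_i are
   orthogonal. The automorphism Y_i |-> X_i carries the metric to
   omega_1^2 + omega_2^2 + |Y_3|^2 omega_3^2. *)

From HB Require Import structures.
Require Import Defs.
From mathcomp Require Import all_boot all_order all_algebra.
From mathcomp Require Import all_classical all_reals all_analysis.
From mathcomp Require Import ring lra.

Set Implicit Arguments.
Unset Strict Implicit.
Unset Printing Implicit Defensive.

Import Order.TTheory GRing.Theory Num.Theory.
Import numFieldNormedType.Exports.

Local Open Scope classical_set_scope.
Local Open Scope ring_scope.

(** * Calculus of C^k maps *)

Section Smoothness.
Variable R : realType.
Implicit Types V W : normedModType R.

Lemma linear_is_diff V W (L : V -> W) (x : V) :
  linear L -> continuous L -> is_diff x L L.
Proof.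
move=> linL cL.
pose LM := GRing.isLinear.Build _ _ _ _ _ linL.
pose L' : {linear V -> W} := HB.pack L LM.
have <- : (L' : V -> W) = L by [].
by apply: DiffDef; [exact: linear_differentiable | rewrite diff_lin].
Qed.

(** Serves the product rule, where the derivative of a product still contains the undifferentiated
    factors. *)
Lemma Ck_pred V W k (f : V -> W) : Ck k.+1 f -> Ck k f.
Proof.
elim: k f => [|k IH] f [df ddf].
  by move=> x; exact: differentiable_continuous.
by split=> // v; exact: IH.
Qed.

Lemma Ck_cst V W k (c : W) : Ck k (fun _ : V => c).
Proof.
elim: k c => [|k IH] c; first exact: cst_continuous.
split=> [x|v]; first exact: differentiable_cst.
under eq_fun do rewrite diff_cst.
exact: (IH 0).
Qed.

Lemma CkD V W k (f g : V -> W) : Ck k f -> Ck k g -> Ck k (fun x => f x + g x).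
Proof.
elim: k f g => [|k IH] f g.
  by move=> cf cg x; exact: (continuousD (cf x) (cg x)).
move=> [df ddf] [dg ddg]; split=> [x|v]; first exact: differentiableD.
under eq_fun do rewrite (diffD (df _) (dg _)).
exact: (IH _ _ (ddf v) (ddg v)).
Qed.

Lemma CkM V k (f g : V -> R) :
  Ck k (f : V -> R^o) -> Ck k (g : V -> R^o) ->
  Ck k ((fun x => f x * g x) : V -> R^o).
Proof.
elim: k f g => [|k IH] f g.
  by move=> cf cg x; exact: (continuousM (cf x) (cg x)).
move=> Cf Cg; have [df ddf] := Cf; have [dg ddg] := Cg.
split=> [x|v]; first exact: differentiableM.
under eq_fun do rewrite (diffM (df _) (dg _)).
exact: (CkD (IH _ _ (Ck_pred Cf) (ddg v)) (IH _ _ (Ck_pred Cg) (ddf v))).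
Qed.

(** A continuous linear map commutes with differentiation, so the induction on [k] passes through
    [L]. *)
Lemma Ck_linear V (W W' : normedModType R) k (L : W -> W') (f : V -> W) :
  linear L -> continuous L -> Ck k f -> Ck k (fun x => L (f x)).
Proof.
move=> linL cL; elim: k f => [|k IH] f.
  by move=> cf x; apply: continuous_comp; [exact: cf | exact: cL].
move=> [df ddf].
have dL y : is_diff y L L by exact: linear_is_diff.
have dLf x : is_diff x (L \o f) (L \o 'd f x).
  by apply: is_diff_comp (dL _); exact/differentiableP.
split=> [x|v]; first exact: ex_diff.
have -> : (fun x => 'd (fun x => L (f x)) x v) = fun x => L ('d f x v).
  by apply/funext => x; rewrite (diff_val (is_diff_def := dLf x)).
exact: IH (ddf v).
Qed.

Lemma Ck_id V k : Ck k (fun x : V => x).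
Proof.
case: k => [|k]; first by move=> x; exact: cvg_id.
have did x : is_diff x (fun x : V => x) id by exact: is_diff_id.
split=> [x|v]; first exact: ex_diff.
under eq_fun do rewrite (diff_val (is_diff_def := did _)).
exact: Ck_cst.
Qed.

Lemma CkZl V W k (p : V -> R) (w : W) :
  Ck k (p : V -> R^o) -> Ck k (fun x => p x *: w).
Proof.
apply: (@Ck_linear V R^o W k ( *:%R ^~ w)); last exact: scalel_continuous.
by move=> a x y; rewrite scalerDl scalerA.
Qed.

Lemma Ck_coord V n k (f : V -> 'rV[R]_n.+1) i :
  Ck k f -> Ck k ((fun x => f x 0 i) : V -> R^o).
Proof.
apply: (@Ck_linear V _ R^o k (fun w : 'rV[R]_n.+1 => w 0 i)).
  by move=> a x y; rewrite !mxE.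
exact: coord_continuous.
Qed.

Lemma Ck_sum V W k (I : Type) (r : seq I) (F : I -> V -> W) :
  (forall i, Ck k (F i)) -> Ck k (fun x => \sum_(i <- r) F i x).
Proof.
move=> CF; elim: r => [|i r IH].
  under eq_fun do rewrite big_nil.
  exact: Ck_cst.
under eq_fun do rewrite big_cons.
exact: CkD.
Qed.

Lemma Ck_mulmxr V n m k (f : V -> 'rV[R]_n.+1) (A : 'M[R]_(n.+1, m.+1)) :
  Ck k f -> Ck k (fun x => f x *m A).
Proof.
move=> Cf; under eq_fun do rewrite mulmx_sum_row.
by apply: Ck_sum => i; apply: CkZl; exact: Ck_coord.
Qed.

End Smoothness.

(** * The Heisenberg group in exponential coordinates *)

Section Heisenberg.
Variable R : realType.
Implicit Types (x y v w : 'rV[R]_3) (A B : 'M[R]_3).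

Lemma rV3P v w : v 0 idx1 = w 0 idx1 -> v 0 idx2 = w 0 idx2 ->
  v 0 idx3 = w 0 idx3 -> v = w.
Proof. by move=> v1 v2 v3; apply/rowP; elim/ord3P. Qed.

Lemma honeE : hone R = 0.
Proof. by apply: rV3P; rewrite !mxE. Qed.

Lemma hmulE x y : hmul x y = x + y + (x 0 idx1 * y 0 idx2) *: basisX R idx3.
Proof. by apply: rV3P; rewrite !mxE /= ?mxE sum3E !mxE /=; ring. Qed.

Lemma hinvE x : hinv x = - x + (x 0 idx1 * x 0 idx2) *: basisX R idx3.
Proof.
set y := RHS.
have yx : hmx y *m hmx x = 1%:M.
  by apply/matrixP; elim/ord3P; elim/ord3P; rewrite /y !mxE sum3E !mxE /=; ring.
have xU : hmx x \in unitmx by have [] := mulmx1_unit yx.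
by rewrite /hinv -[RHS]hmxK -[hmx y]mulmx1 -(mulmxV xU) mulmxA yx mul1mx.
Qed.

(* The exponential map of H3, read in the chart. *)
Definition hexp v : 'rV[R]_3 :=
  v + (2^-1 * (v 0 idx1 * v 0 idx2)) *: basisX R idx3.

Definition hlog x : 'rV[R]_3 :=
  x - (2^-1 * (x 0 idx1 * x 0 idx2)) *: basisX R idx3.

(** The Lie bracket of h_3, in coordinates with respect to X_1, X_2, X_3. *)
Definition brk v w : 'rV[R]_3 :=
  (v 0 idx1 * w 0 idx2 - v 0 idx2 * w 0 idx1) *: basisX R idx3.

Lemma hexpK : cancel hexp hlog.
Proof. by move=> v; apply: rV3P; rewrite !mxE /=; field. Qed.

Lemma hlogK : cancel hlog hexp.
Proof. by move=> v; apply: rV3P; rewrite !mxE /=; field. Qed.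

Lemma hexp0 : hexp 0 = 0.
Proof. by apply: rV3P; rewrite !mxE /=; ring. Qed.

Lemma hlog0 : hlog 0 = 0.
Proof. by rewrite -{1}hexp0 hexpK. Qed.

(** The Baker-Campbell-Hausdorff formula, which stops at the first bracket because h_3 is two-step
    nilpotent. *)
Lemma hmul_hexp v w : hmul (hexp v) (hexp w) = hexp (v + w + 2^-1 *: brk v w).
Proof. by rewrite hmulE; apply: rV3P; rewrite !mxE /=; field. Qed.

Lemma brkDl v v' w : brk (v + v') w = brk v w + brk v' w.
Proof. by apply: rV3P; rewrite !mxE /=; ring. Qed.

Lemma brkDr v w w' : brk v (w + w') = brk v w + brk v w'.
Proof. by apply: rV3P; rewrite !mxE /=; ring. Qed.

Lemma brkZ a b v w : brk (a *: v) (b *: w) = (a * b) *: brk v w.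
Proof. by apply: rV3P; rewrite !mxE /=; ring. Qed.

Lemma brk0v w : brk 0 w = 0.
Proof. by apply: rV3P; rewrite !mxE /=; ring. Qed.

Lemma brkv0 v : brk v 0 = 0.
Proof. by apply: rV3P; rewrite !mxE /=; ring. Qed.

(** Lie algebra endomorphisms of h_3. Matrices act on row vectors from the right, so products appear
    in the reverse order of compositions. *)
Definition bracket_mx A := forall v w, brk (v *m A) (w *m A) = brk v w *m A.

Lemma bracket_mxV A : A \in unitmx -> bracket_mx A -> bracket_mx (invmx A).
Proof.
move=> uA bA v w; have := bA (v *m invmx A) (w *m invmx A).
by rewrite !mulmxKV // => ->; rewrite mulmxK.
Qed.

Lemma bracket_mxM A B : bracket_mx A -> bracket_mx B -> bracket_mx (A *m B).
Proof. by move=> bA bB v w; rewrite !mulmxA bB bA. Qed.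

Definition linaut A x : 'rV[R]_3 := hexp (hlog x *m A).

Lemma linaut_comp A B x : linaut B (linaut A x) = linaut (A *m B) x.
Proof. by rewrite /linaut hexpK mulmxA. Qed.

Lemma linaut1 x : linaut 1%:M x = x.
Proof. by rewrite /linaut mulmx1 hlogK. Qed.

Lemma linaut_inj A B : linaut A =1 linaut B -> A = B.
Proof.
move=> AB; apply/row_matrixP => i; rewrite !rowE.
have := congr1 hlog (AB (hexp (delta_mx 0 i))).
by rewrite /linaut !hexpK.
Qed.

(** By [hmul_hexp] the group product is built from sums and brackets, and [A] respects both. *)
Lemma linautM A : bracket_mx A ->
  forall x y, linaut A (hmul x y) = hmul (linaut A x) (linaut A y).
Proof.
move=> bA x y; rewrite -[in LHS](hlogK x) -[in LHS](hlogK y) hmul_hexp.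
by rewrite /linaut hexpK hmul_hexp bA !mulmxDl scalemxAl.
Qed.

Lemma Ck_hexp (V : normedModType R) k (f : V -> 'rV[R]_3) :
  Ck k f -> Ck k (fun u => hexp (f u)).
Proof.
move=> Cf; apply: (CkD Cf); apply: CkZl.
apply: (@CkM _ _ k (fun _ => 2^-1) (fun u => f u 0 idx1 * f u 0 idx2)).
  exact: Ck_cst.
by apply: (@CkM _ _ k (fun u => f u 0 idx1) (fun u => f u 0 idx2));
  exact: Ck_coord.
Qed.

Lemma smooth_hexp : smooth (hexp : 'rV[R]_3 -> 'rV[R]_3).
Proof. by move=> k; exact/Ck_hexp/Ck_id. Qed.

(** The quadratic correction is even, so the outer sign reverses it. Smoothness of [hlog] thereby
    reduces to that of [hexp]. *)
Lemma hlog_hexp x : hlog x = - hexp (- x).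
Proof. by apply: rV3P; rewrite !mxE /=; ring. Qed.

Lemma smooth_hlog : smooth hlog.
Proof.
move=> k.
have CkN (f : 'rV[R]_3 -> 'rV[R]_3) : Ck k f -> Ck k (fun x => - f x).
  move=> Cf; under eq_fun do rewrite -[- _]mulmx1 mulNmx -mulmxN.
  exact: Ck_mulmxr.
rewrite (_ : hlog = fun x => - hexp (- x)); last exact/funext/hlog_hexp.
exact/CkN/Ck_hexp/CkN/Ck_id.
Qed.

Lemma smooth_linaut A : smooth (linaut A).
Proof. by move=> k; exact/Ck_hexp/Ck_mulmxr/smooth_hlog. Qed.

Lemma linaut_diffeo A : A \in unitmx -> diffeomorphism (linaut A).
Proof.
move=> uA; exists (linaut (invmx A)); split; try exact: smooth_linaut.
  by move=> x; rewrite linaut_comp mulmxV // linaut1.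
by move=> x; rewrite linaut_comp mulVmx // linaut1.
Qed.

Lemma linaut_lie A :
  A \in unitmx -> bracket_mx A -> lie_automorphism (linaut A).
Proof. by move=> uA bA; split; [exact: linautM | exact: linaut_diffeo]. Qed.

Lemma smooth_differentiable (f : 'rV[R]_3 -> 'rV[R]_3) x :
  smooth f -> differentiable f x.
Proof. by move=> /(_ 1%N) []. Qed.

Lemma is_diff_mulmxr x A :
  is_diff x (fun y : 'rV[R]_3 => y *m A) (fun y => y *m A).
Proof.
apply: linear_is_diff; first by move=> a v w; rewrite mulmxDl scalemxAl.
exact: (@Ck_mulmxr _ _ _ _ 0 id A (@Ck_id _ _ 0)).
Qed.

Lemma is_diff_coord i x :
  is_diff x (fun y : 'rV[R]_3 => y 0 i : R) (fun y => y 0 i).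
Proof.
apply: linear_is_diff; first by move=> a v w; rewrite !mxE.
exact: coord_continuous.
Qed.

(** The correction term is quadratic, hence has zero differential at 0. *)
Lemma is_diff_hexp0 : is_diff (0 : 'rV[R]_3) hexp id.
Proof.
have d1 := is_diff_coord idx1 0; have d2 := is_diff_coord idx2 0.
have dq : is_diff (0 : 'rV[R]_3)
    (fun y : 'rV[R]_3 => 2^-1 * (y 0 idx1 * y 0 idx2) : R) 0.
  apply: (is_diff_eq (is_diffZ 2^-1 (is_diffM d1 d2))).
  by apply/funext => y; rewrite !fctE !mxE !scale0r addr0 scaler0.
have dqe : is_diff (0 : 'rV[R]_3)
    (fun y : 'rV[R]_3 => (2^-1 * (y 0 idx1 * y 0 idx2)) *: basisX R idx3) 0.
  apply: DiffDef; first exact/differentiableZl/ex_diff.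
  rewrite diffZl; last exact: ex_diff.
  by apply/funext => y; rewrite diff_val scale0r.
rewrite -[X in is_diff _ _ X]addr0; exact: is_diffD.
Qed.

(** Obtained by differentiating [hexp \o hlog = id] at 0. *)
Lemma is_diff_hlog0 : is_diff (0 : 'rV[R]_3) hlog id.
Proof.
have dlog : differentiable hlog (0 : 'rV[R]_3).
  exact/smooth_differentiable/smooth_hlog.
suff dE : 'd hlog (0 : 'rV[R]_3) = id :> (_ -> _) by exact: DiffDef.
have dexp : is_diff (hlog 0 : 'rV[R]_3) hexp id.
  by rewrite hlog0; exact: is_diff_hexp0.
have E := diff_val (is_diff_def := is_diff_comp (differentiableP dlog) dexp).
rewrite -[LHS]E.
have -> : hexp \o hlog = @idfun 'rV[R]_3 by apply/funext => x; exact: hlogK.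
by rewrite (diff_val (is_diff_def := is_diff_id _)).
Qed.

Lemma diff_linaut0 A v : 'd (linaut A) (0 : 'rV[R]_3) v = v *m A.
Proof.
have dA := is_diff_comp is_diff_hlog0 (is_diff_mulmxr (hlog 0) A).
have dexp : is_diff (((fun y : 'rV[R]_3 => y *m A) \o hlog) 0) hexp id.
  by rewrite /= hlog0 mul0mx; exact: is_diff_hexp0.
have E := diff_val (is_diff_def := is_diff_comp dA dexp).
exact: (congr1 (fun h : 'rV[R]_3 -> 'rV[R]_3 => h v) E).
Qed.

End Heisenberg.

Arguments hexp {R} v.
Arguments hlog {R} x.
Arguments linaut {R} A x.

(** * Linearity of Lie automorphisms and the Maurer-Cartan form *)

Section LieAutomorphisms.
Variable R : realType.
Implicit Types (x y v w : 'rV[R]_3) (A B : 'M[R]_3).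
(* If F commutes with the multiplication by positive integers then F v is the
   constant value of n F(v / n), which tends to dF_0(v). *)
Lemma natural_homogeneous_diff (F : 'rV[R]_3 -> 'rV[R]_3) :
  differentiable F 0 -> (forall n v, F (v *+ n) = F v *+ n) ->
  forall v, F v = 'd F 0 v.
Proof.
move=> dF FM v; rewrite -deriveE //.
have F0 : F 0 = 0 by rewrite -(mulr0n 0) FM.
have := @diff_derivable _ _ _ F 0 v dF; rewrite /derivable.
move=> /cvg_ex[l Fl]; rewrite /derive (cvg_lim _ Fl) //.
(* Difference quotients range over punctured neighbourhoods of 0, so 1/(n+1) has to tend to 0
   without vanishing. *)
have harm : (@harmonic R) @ \oo --> (0 : R)^'.
  move=> P /= [e e0 eP].
  have /cvgrPdist_lt/(_ e e0) := @cvg_harmonic R.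
  apply: filterS => n ne; apply: eP => //.
  by rewrite gt_eqF // harmonic_gt0.
have := cvg_comp _ _ harm Fl.
(* At h = 1/(n+1) the quotient is (n+1) F(v/(n+1)), that is F(v). *)
have -> : (fun h : R => h^-1 *: ((F \o shift 0) (h *: v) - F 0)) \o harmonic
    = fun _ => F v.
  apply/funext => n /=; rewrite F0 subr0 addr0 invrK.
  by rewrite scaler_nat -FM -scaler_nat scalerA mulfV ?scale1r // pnatr_eq0.
by move=> /cvg_lim <-; rewrite ?lim_cst.
Qed.

(** Proportional vectors have zero bracket, so their exponentials multiply by adding exponents. *)
Lemma hexpMn v n : hexp (v *+ n.+1) = hmul (hexp (v *+ n)) (hexp v).
Proof.
rewrite hmul_hexp (_ : brk _ _ = 0) ?scaler0 ?addr0 -?mulrSr //.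
by rewrite -scaler_nat; apply: rV3P; rewrite !mxE /=; ring.
Qed.

Lemma hmulA : associative (@hmul R).
Proof. by move=> x y z; rewrite !hmulE; apply: rV3P; rewrite !mxE /=; ring. Qed.

Lemma hmul0x : left_id 0 (@hmul R).
Proof. by move=> x; rewrite hmulE; apply: rV3P; rewrite !mxE /=; ring. Qed.

Lemma hmulVx x : hmul (hinv x) x = 0.
Proof. by rewrite hmulE hinvE; apply: rV3P; rewrite !mxE /=; ring. Qed.

Lemma hmulxV x : hmul x (hinv x) = 0.
Proof. by rewrite hmulE hinvE; apply: rV3P; rewrite !mxE /=; ring. Qed.

Lemma lie_automorphism_linaut (f : H3 R -> H3 R) : lie_automorphism f ->
  exists2 A, bracket_mx A & f = linaut A.
Proof.
move=> [fM [f' [fK f'K Cf Cf']]].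
have f0 : f 0 = 0.
  have := congr1 (hmul (hinv (f 0))) (fM 0 0).
  by rewrite hmul0x hmulA !hmulVx hmul0x.
pose F v := hlog (f (hexp v)).
have FMn n v : F (v *+ n) = F v *+ n.
  apply: (can_inj (@hexpK R)); rewrite /F hlogK.
  elim: n => [|n IH]; first by rewrite !mulr0n hexp0.
  by rewrite !hexpMn fM IH hlogK.
have dF : differentiable F 0.
  have d1 x : differentiable hexp (x : 'rV[R]_3).
    exact/smooth_differentiable/smooth_hexp.
  have d2 x : differentiable f (x : 'rV[R]_3) by exact: smooth_differentiable.
  have d3 x : differentiable hlog (x : 'rV[R]_3).
    exact/smooth_differentiable/smooth_hlog.
  rewrite -[F]/(hlog \o (f \o hexp)).
  by do 2 apply: differentiable_comp => //.
have FA v : F v = v *m lin1_mx ('d F 0).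
  by rewrite mul_rV_lin1; exact: natural_homogeneous_diff.
exists (lin1_mx ('d F 0)); last first.
  by apply/funext => x; rewrite /linaut -FA /F !hlogK.
(* Expand both sides of f(exp v exp w) = f(exp v) f(exp w) by [hmul_hexp]: the linear terms cancel
   and the halved brackets remain. *)
move=> v w; rewrite -!FA.
have := fM (hexp v) (hexp w).
rewrite hmul_hexp -[f (hexp v)]hlogK -[f (hexp w)]hlogK hmul_hexp.
move=> /(congr1 hlog); rewrite hexpK -!/(F _) !FA !mulmxDl => /addrI.
by rewrite -scalemxAl => /scalerI ->.
Qed.

Lemma linaut0 A : linaut A 0 = 0.
Proof. by rewrite /linaut hlog0 mul0mx hexp0. Qed.

Lemma linautV A x : bracket_mx A -> linaut A (hinv x) = hinv (linaut A x).
Proof.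
move=> bA; rewrite -[LHS]hmul0x -(hmulVx (linaut A x)) -hmulA -linautM //.
rewrite hmulxV linaut0.
by rewrite hmulE; apply: rV3P; rewrite !mxE /=; ring.
Qed.

(** Left translations are affine in the chart, so the differential is the same at every [x]. *)
Lemma is_diff_hmul a x :
  is_diff x (hmul a : 'rV[R]_3 -> 'rV[R]_3)
    (fun v => v + (a 0 idx1 * v 0 idx2) *: basisX R idx3).
Proof.
set L := (X in is_diff _ _ X).
have LL : linear L.
  by move=> c v w; apply: rV3P; rewrite !mxE /=; ring.
have CL : continuous L.
  apply: (@CkD _ _ _ 0); first exact: (@Ck_id _ _ 0).
  apply: (@CkZl _ _ _ 0); apply: (@CkM _ _ 0 (fun _ => _) (fun v => v 0 idx2)).
    exact: Ck_cst.
  by apply: Ck_coord; exact: (@Ck_id _ _ 0).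
have dL := linear_is_diff x LL CL.
have -> : hmul a = cst a + L.
  by apply/funext => y; rewrite hmulE -addrA.
by rewrite -[X in is_diff _ _ X]add0r; exact: is_diffD.
Qed.

Lemma diff_hmul a x v :
  'd (hmul a : 'rV[R]_3 -> 'rV[R]_3) x v =
  v + (a 0 idx1 * v 0 idx2) *: basisX R idx3.
Proof. by have d := is_diff_hmul a x; rewrite diff_val. Qed.

(* The Maurer-Cartan form. *)
Definition mcartan x v : 'rV[R]_3 :=
  'd (hmul (hinv x) : 'rV[R]_3 -> 'rV[R]_3) x v.

Lemma mcartanE x v : mcartan x v = v - (x 0 idx1 * v 0 idx2) *: basisX R idx3.
Proof.
by rewrite /mcartan diff_hmul hinvE; apply: rV3P; rewrite !mxE /=; ring.
Qed.

Lemma mcartan_hmul a x v :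
  mcartan (hmul a x) ('d (hmul a : 'rV[R]_3 -> 'rV[R]_3) x v) = mcartan x v.
Proof.
by rewrite diff_hmul !mcartanE hmulE; apply: rV3P; rewrite !mxE /=; ring.
Qed.

(** An automorphism f satisfies L_{f(x)^-1} f = f L_{x^-1}. Differentiating both sides at [x]
    leaves, on the right, the differential of f at the identity, which is [A]. *)
Lemma mcartan_linaut A x v : bracket_mx A ->
  mcartan (linaut A x) ('d (linaut A) x v) = mcartan x v *m A.
Proof.
move=> bA.
have dA y : differentiable (linaut A) y.
  exact/smooth_differentiable/smooth_linaut.
have dl a y : differentiable (hmul a : 'rV[R]_3 -> 'rV[R]_3) y.
  exact: (ex_diff (is_diff_def := is_diff_hmul a y)).
have comm : hmul (hinv (linaut A x)) \o linaut A = linaut A \o hmul (hinv x).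
  by apply/funext => y /=; rewrite linautM // linautV.
have E1 := diff_comp (dA x) (dl (hinv (linaut A x)) (linaut A x)).
have E2 := diff_comp (dl (hinv x) x) (dA (hmul (hinv x) x)).
have app (f g : 'rV[R]_3 -> 'rV[R]_3) : f = g -> f v = g v by move=> ->.
move: E1; rewrite comm => E1.
rewrite -[RHS]diff_linaut0 -(hmulVx x).
exact: (app _ _ (etrans (esym E1) E2)).
Qed.

End LieAutomorphisms.

(** * Characters of Z_2^2 *)

Section Characters.
Variable R : realType.
Implicit Types (d c : Gamma).

Definition chi d c : R := (-1) ^+ (d.1 * c.1 + d.2 * c.2)%N.

Lemma Z2P (P : 'Z_2 -> Prop) : P 0 -> P 1 -> forall i, P i.
Proof.
move=> P0 P1 [[|[|//]] i2].
  by rewrite (_ : Ordinal _ = 0) //; exact: val_inj.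
by rewrite (_ : Ordinal _ = 1) //; exact: val_inj.
Qed.

Lemma GammaP (P : Gamma -> Prop) :
  P (0, 0) -> P (0, 1) -> P (1, 0) -> P (1, 1) -> forall c, P c.
Proof. by move=> P0 P1 P2 P3 [c1 c2]; elim/Z2P: c1; elim/Z2P: c2. Qed.

Lemma GammaDD c : c + c = 0.
Proof. by elim/GammaP: c; apply/eqP. Qed.

Lemma chiC d c : chi d c = chi c d.
Proof. by rewrite /chi mulnC [X in (_ + X)%N]mulnC. Qed.

Lemma chiDr d c c' : chi d (c + c') = chi d c * chi d c'.
Proof.
(* Addition in Z_2 wraps around, so the exponents agree only modulo 2. *)
rewrite /chi -exprD -signr_odd -[RHS]signr_odd; congr (_ ^+ nat_of_bool _).
by elim/GammaP: d; elim/GammaP: c; elim/GammaP: c'.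
Qed.

Lemma chiDl d d' c : chi (d + d') c = chi d c * chi d' c.
Proof. by rewrite chiC chiDr !(chiC c). Qed.

Lemma chi0 d : chi d 0 = 1.
Proof. by rewrite /chi !muln0 expr0. Qed.

Lemma chi_sqr d c : chi d c * chi d c = 1.
Proof. by rewrite -chiDr GammaDD chi0. Qed.

Lemma chi_nontrivial d : d != 0 -> exists c, chi d c = -1.
Proof.
elim/GammaP: d => // _; first by exists (0, 1); rewrite /chi expr1.
  by exists (1, 0); rewrite /chi expr1.
by exists (1, 0); rewrite /chi expr1.
Qed.

Lemma chi_separates d d' : d != d' -> exists c, chi d c = - chi d' c.
Proof.
rewrite -subr_eq0 => /chi_nontrivial[c dc]; exists c.
by rewrite -{1}(subrK d' d) chiDl dc mulN1r.
Qed.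

(** Orthogonality of characters: for nonzero [c], shifting the index by some [d0] with
    [chi d0 c = -1] turns the sum into its opposite. *)
Lemma sum_chi c : \sum_d chi d c = 4 *+ (c == 0).
Proof.
have [->|/chi_nontrivial[d0 cd0]] := eqVneq c 0.
  under eq_bigr do rewrite chi0.
  by rewrite sumr_const card_prod !card_ord.
rewrite mulr0n; set S := LHS; suff : S = - S by lra.
rewrite {1}/S (reindex_inj (addrI d0)) /= -sumrN.
by under eq_bigr do rewrite chiDl [chi d0 c]chiC cd0 mulN1r.
Qed.

End Characters.

(** * Isotypic decomposition of h_3 *)

Section Homogeneous.
Variables (R : realType) (A : Gamma -> 'M[R]_3).
Hypothesis A0 : A 0 = 1%:M.
Hypothesis AD : forall c c', A (c + c') = A c' *m A c.
Hypothesis brkA : forall c, bracket_mx (A c).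
Implicit Types (v w : 'rV[R]_3) (d c : Gamma).

Definition homogeneous d v := forall c, v *m A c = chi R d c *: v.

(** Four times the projection onto the component of degree [d]. *)
Definition isotypic d v : 'rV[R]_3 := \sum_c chi R d c *: (v *m A c).

Lemma isotypic_homogeneous d v : homogeneous d (isotypic d v).
Proof.
move=> c; rewrite /isotypic mulmx_suml scaler_sumr.
rewrite [RHS](reindex_inj (addrI c)) /=; apply: eq_bigr => c' _.
rewrite -scalemxAl -mulmxA -AD scalerA chiDr mulrA chi_sqr mul1r.
by [].
Qed.

(** After exchanging the sums, orthogonality of characters leaves only the term of [c = 0]. *)
Lemma sum_isotypic v : \sum_d isotypic d v = 4 *: v.
Proof.
rewrite exchange_big /=; under eq_bigr do rewrite -scaler_suml sum_chi.
rewrite (bigD1 (0 : Gamma)) // eqxx A0 mulmx1 big1 => [|c /negPf ->].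
  exact: addr0.
by rewrite scale0r.
Qed.

Lemma homogeneous_brk d d' v w : homogeneous d v -> homogeneous d' w ->
  homogeneous (d + d') (brk v w).
Proof. by move=> hv hw c; rewrite -brkA hv hw brkZ chiDl. Qed.

Lemma homogeneousZ d a v : homogeneous d v -> homogeneous d (a *: v).
Proof. by move=> hv c; rewrite -scalemxAl hv !scalerA mulrC. Qed.

(* [X_1, X_2] <> 0 is a sum of brackets of homogeneous vectors. *)
Lemma homogeneous_generators : exists d1 d2 v w,
  [/\ homogeneous d1 v, homogeneous d2 w & brk v w != 0].
Proof.
pose P d d' := brk (isotypic d (basisX R idx1)) (isotypic d' (basisX R idx2)).
(* The factor 16 is 4 * 4, one 4 from each unnormalised projection. *)
have sumP : \sum_d \sum_d' P d d' = 16 *: basisX R idx3.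
  have brkr v : {morph brk v : w w' / w + w'} by move=> ? ?; exact: brkDr.
  have brkl w : {morph (fun v => brk v w) : v v' / v + v'}.
    by move=> ? ?; exact: brkDl.
  under eq_bigr do rewrite -(big_morph _ (brkr _) (brkv0 _)) sum_isotypic.
  rewrite -(big_morph _ (brkl _) (brk0v _)) sum_isotypic brkZ.
  by apply: rV3P; rewrite !mxE /=; ring.
have [d1 [d2 Pne]] : exists d1 d2, P d1 d2 != 0.
  apply: contrapT => /forallNP P0; move: sumP.
  rewrite big1 => [/rowP/(_ idx3)|d _].
    by rewrite !mxE /=; lra.
  by rewrite big1 // => d' _; have /forallNP/(_ d')/negP := P0 d;
    rewrite negbK => /eqP.
exists d1, d2, (isotypic d1 (basisX R idx1)), (isotypic d2 (basisX R idx2)).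
by split=> //; exact: isotypic_homogeneous.
Qed.

End Homogeneous.

(** * Left-invariant metrics and the constraints imposed by symmetries *)

Section Metrics.
Variable R : realType.
Implicit Types (x v w : 'rV[R]_3) (A : 'M[R]_3) (g h : tensor2 R) (a : R).

Lemma left_invariantE g x v w : left_invariant g ->
  g x v w = g 0 (mcartan x v) (mcartan x w).
Proof. by move=> /(_ (hinv x) x v w) <-; rewrite hmulVx. Qed.

(** Left-invariant metrics are inner products at the identity composed with the Maurer-Cartan form,
    on which the automorphism acts by [A]. Comparing at the identity is therefore enough. *)
Lemma pulls_back_linaut A g h : bracket_mx A ->
  left_invariant g -> left_invariant h ->
  (forall v w, h 0 (v *m A) (w *m A) = g 0 v w) -> pulls_back (linaut A) h g.
Proof.
move=> bA gL hL hA x v w /=.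
by rewrite left_invariantE // !mcartan_linaut // hA -left_invariantE.
Qed.

Lemma mcartan0 v : mcartan 0 v = v.
Proof. by rewrite mcartanE mxE mul0r scale0r subr0. Qed.

Definition standard_form a v w : R :=
  v 0 idx1 * w 0 idx1 + v 0 idx2 * w 0 idx2 + a ^+ 2 * (v 0 idx3 * w 0 idx3).

Lemma standard_metricE a x v w :
  standard_metric a x v w = standard_form a (mcartan x v) (mcartan x w).
Proof. by []. Qed.

Lemma standard_left_invariant a : left_invariant (standard_metric a).
Proof. by move=> b x v w /=; rewrite !standard_metricE !mcartan_hmul. Qed.

Lemma standard_riemannian a : a != 0 -> riemannian_metric (standard_metric a).
Proof.
move=> a0.
split.
- move=> x v1 v2 w b; rewrite !standard_metricE /standard_form !mcartanE !mxE.
  by ring.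
- by move=> x v w; rewrite !standard_metricE /standard_form; ring.
- move=> x v v0; rewrite standard_metricE /standard_form; set y := mcartan x v.
  (* In the chart [mcartan x] is unitriangular, hence injective. *)
  have y0 : y != 0.
    apply: contraNneq v0 => y0; apply/eqP.
    move: y0; rewrite /y mcartanE => /rowP y0.
    have := y0 idx1; have := y0 idx2; have := y0 idx3.
    rewrite !mxE /= !mulr0 !subr0 => v3 v2 v1; apply: rV3P; rewrite ?mxE //.
    by move: v3; rewrite v2 !mulr0 mul0r subr0.
  rewrite -!expr2 -exprMn lt_neqAle eq_sym !addr_ge0 ?sqr_ge0 // andbT.
  apply: contra y0.
  rewrite !paddr_eq0 ?addr_ge0 ?sqr_ge0 // !sqrf_eq0 mulf_eq0 (negPf a0) /=.
  by move=> /andP[/andP[/eqP y1 /eqP y2] /eqP y3]; apply/eqP;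
    apply: rV3P; rewrite ?mxE.
- move=> v w k; under eq_fun do rewrite standard_metricE /standard_form.
  have Cm u i : Ck k ((fun x => mcartan x u 0 i) : 'rV[R]_3 -> R^o).
    apply: (@Ck_coord _ _ _ k (fun x : 'rV[R]_3 => mcartan x u)).
    under eq_fun do rewrite mcartanE mulrC -scaleNr -mulNr.
    apply: CkD; first exact: Ck_cst.
    apply: CkZl; apply: (@CkM _ _ k (fun=> _) (fun x => x 0 idx1)).
      exact: Ck_cst.
    exact/Ck_coord/Ck_id.
  have Cmm i :
      Ck k ((fun x => mcartan x v 0 i * mcartan x w 0 i) : 'rV[R]_3 -> R^o).
    by apply: (@CkM _ _ k (fun x => mcartan x v 0 i)
      (fun x => mcartan x w 0 i)).
  apply: (@CkD _ _ _ k
    (fun x => mcartan x v 0 idx1 * mcartan x w 0 idx1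
              + mcartan x v 0 idx2 * mcartan x w 0 idx2 : R^o)).
    exact: (@CkD _ _ _ k
      (fun x => mcartan x v 0 idx1 * mcartan x w 0 idx1 : R^o)).
  apply: (@CkM _ _ k (fun=> _)); [exact: Ck_cst | exact: Cmm].
Qed.

Lemma metric_addl g x u v w : riemannian_metric g ->
  g x (u + v) w = g x u w + g x v w.
Proof. by move=> [gl _ _ _]; have := gl x u v w 1; rewrite scale1r mul1r. Qed.

Lemma metric_scalel g x a v w : riemannian_metric g ->
  g x (a *: v) w = a * g x v w.
Proof.
move=> gR; have g0 : g x 0 w = 0.
  by apply: (addrI (g x 0 w)); rewrite addr0 -metric_addl // addr0.
by have [gl _ _ _] := gR; have := gl x v 0 w a; rewrite !addr0 g0 addr0.
Qed.

(** Some symmetry acts on [v] and [w] with opposite signs; it both preserves and negates their inner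
    product. *)
Lemma homogeneous_orthogonal g (A : Gamma -> 'M[R]_3) d d' v w :
  riemannian_metric g ->
  (forall c v w, g 0 (v *m A c) (w *m A c) = g 0 v w) ->
  homogeneous A d v -> homogeneous A d' w -> d != d' -> g 0 v w = 0.
Proof.
move=> gR gA hv hw /(chi_separates R)[c dc]; have [_ gs _ _] := gR.
have gZ b u t : g 0 (b *: u) t = b * g 0 u t by exact: metric_scalel.
have := gA c v w; rewrite hv hw gZ gs gZ gs dc mulrA mulNr chi_sqr => e.
by apply/eqP; move/eqP: e;
  rewrite mulN1r eq_sym -subr_eq0 opprK -mulr2n mulrn_eq0.
Qed.

(** The line exp(R v) is connected, passes through the identity and consists of fixed points, so it
    is reduced to the identity. *)
Lemma fixed_vector_eq0 (rho : Gamma -> H3 R -> H3 R) (A : Gamma -> 'M[R]_3) v :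
  connected_component (fixed_set rho) (hone R) `<=` [set hone R] ->
  (forall c, rho c = linaut (A c)) -> homogeneous A 0 v -> v = 0.
Proof.
rewrite honeE => cc rhoE hv.
pose C : set 'rV[R]_3 := range (fun t : R => hexp (t *: v)).
have C0 : C 0 by exists 0 => //=; rewrite scale0r hexp0.
have CF : C `<=` fixed_set rho.
  move=> _ [t _ <-] c; rewrite rhoE /linaut hexpK -scalemxAl hv.
  by rewrite chiC chi0 scale1r.
have Cc : connected C.
  apply: connected_continuous_connected; first exact/connected_intervalP.
  apply: continuous_subspaceT.
  exact/(@Ck_hexp _ _ 0)/(@CkZl _ _ _ 0)/(@Ck_id _ _ 0).
have /cc /= : connected_component (fixed_set rho) 0 (hexp v).
  by apply: connected_component_max C0 CF Cc _ _; exists 1; rewrite ?scale1r.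
by move=> /(congr1 hlog); rewrite hexpK hlog0.
Qed.

End Metrics.

(** * Change to a basis adapted to bracket and metric *)

Section AdaptedBasis.
Variables (R : realType) (y : 'I_3 -> 'rV[R]_3).
Implicit Types (v w : 'rV[R]_3).

Definition basis_mx : 'M[R]_3 := \matrix_i y i.

Lemma mul_basis_mx v :
  v *m basis_mx = v 0 idx1 *: y idx1 + v 0 idx2 *: y idx2 + v 0 idx3 *: y idx3.
Proof.
by apply/rowP => j; rewrite !mxE sum3E !mxE.
Qed.

(** Being a multiple of X_3, [y idx3] is central, so the [y i] satisfy the bracket relations of the
    X_i. *)
Lemma bracket_basis_mx t : brk (y idx1) (y idx2) = y idx3 ->
  y idx3 = t *: basisX R idx3 -> bracket_mx basis_mx.
Proof.
move=> y12 y3 v w; rewrite [RHS]mul_basis_mx !mxE /=.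
rewrite !mulr0 !scale0r !add0r mulr1.
rewrite -y12 !mul_basis_mx y3.
by apply: rV3P; rewrite !mxE /=; ring.
Qed.

Lemma metric_basis_mx (g : tensor2 R) a : riemannian_metric g ->
  g 0 (y idx1) (y idx1) = 1 -> g 0 (y idx2) (y idx2) = 1 ->
  g 0 (y idx3) (y idx3) = a ^+ 2 ->
  g 0 (y idx1) (y idx2) = 0 -> g 0 (y idx1) (y idx3) = 0 ->
  g 0 (y idx2) (y idx3) = 0 ->
  forall v w, g 0 (v *m basis_mx) (w *m basis_mx) = standard_form a v w.
Proof.
move=> gR y11 y22 y33 y12 y13 y23; have [_ gs _ _] := gR.
have gD u u' t : g 0 (u + u') t = g 0 u t + g 0 u' t by exact: metric_addl.
have gZ b u t : g 0 (b *: u) t = b * g 0 u t by exact: metric_scalel.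
have gZr b u t : g 0 t (b *: u) = b * g 0 t u by rewrite gs gZ gs.
have gDr u u' t : g 0 t (u + u') = g 0 t u + g 0 t u'.
  by rewrite gs gD; congr (_ + _); exact: gs.
move=> v w; rewrite !mul_basis_mx !(gD, gZ, gDr, gZr).
rewrite (gs 0 (y idx2) (y idx1)) (gs 0 (y idx3) (y idx1)).
rewrite (gs 0 (y idx3) (y idx2)).
by rewrite y11 y22 y33 y12 y13 y23 /standard_form; ring.
Qed.

End AdaptedBasis.

Theorem theorem4p1 (R : realType) (rho : Gamma -> H3 R -> H3 R)
    (g : tensor2 R) (hg : riemannian_Z22_symmetric rho g) :
  exists (lambda : R) (rho0 : Gamma -> H3 R -> H3 R),
    [/\ lambda != 0,
        riemannian_Z22_symmetric rho0 (standard_metric lambda),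
        standard_grading rho0
      & isometric_structures rho g rho0 (standard_metric lambda)].
Proof.
have [[rhoL rhoD rhoI rhoC _] gR gL gI] := hg.
have [gl gs gp _] := gR.
have /choice[A AP] : forall c, exists A, bracket_mx A /\ rho c = linaut A.
  by move=> c; have [A bA rA] := lie_automorphism_linaut (rhoL c); exists A.
have bA c : bracket_mx (A c) by have [] := AP c.
have rhoE c : rho c = linaut (A c) by have [] := AP c.
have AD c c' : A (c + c') = A c' *m A c.
  by apply: linaut_inj => x; rewrite -rhoE rhoD /= !rhoE linaut_comp.
(* [rho 0] is idempotent and injective, hence the identity. *)
have A0 : A 0 = 1%:M.
  have [_ [f' [fK _ _ _]]] := rhoL 0.
  apply: linaut_inj => x; rewrite linaut1 -rhoE; apply: (can_inj fK).
  by rewrite -[LHS]/((rho 0 \o rho 0) x) -rhoD addr0.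
have AA c : A c *m A c = 1%:M by rewrite -AD GammaDD.
have uA c : A c \in unitmx by have [] := mulmx1_unit (AA c).
have gA c v w : g 0 (v *m A c) (w *m A c) = g 0 v w.
  have [_ /(_ 0 v w)] := gI c.
  by rewrite /= rhoE linaut0 !diff_linaut0.
have h0 v : homogeneous A 0 v -> v = 0 by exact: fixed_vector_eq0 rhoC rhoE.
have [d1 [d2 [z1 [z2 [hz1 hz2 z12]]]]] := homogeneous_generators A0 AD.
have z1n : z1 != 0 by apply: contraNneq z12 => ->; rewrite brk0v.
have z2n : z2 != 0 by apply: contraNneq z12 => ->; rewrite brkv0.
pose nrm v := Num.sqrt (g 0 v v).
have nrm_gt0 v : v != 0 -> 0 < nrm v by move=> /gp v0; rewrite sqrtr_gt0.
have nrm_sqr v : v != 0 -> nrm v ^+ 2 = g 0 v v.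
  by move=> /gp/ltW v0; rewrite sqr_sqrtr.
pose unitv v := (nrm v)^-1 *: v.
(* Only two vectors can be normalised: the bracket dictates the third, whose norm survives as
   [lambda]. *)
pose y1 := unitv z1; pose y2 := unitv z2; pose y3 := brk y1 y2.
have hy1 : homogeneous A d1 y1 by exact: homogeneousZ.
have hy2 : homogeneous A d2 y2 by exact: homogeneousZ.
have hy3 : homogeneous A (d1 + d2) y3 by exact: homogeneous_brk.
have y3n : y3 != 0.
  by rewrite /y3 brkZ scaler_eq0 negb_or z12 mulf_neq0 //
    invr_eq0 gt_eqF ?nrm_gt0.
have y1n : y1 != 0 by rewrite scaler_eq0 negb_or z1n invr_eq0 gt_eqF ?nrm_gt0.
have y2n : y2 != 0 by rewrite scaler_eq0 negb_or z2n invr_eq0 gt_eqF ?nrm_gt0.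
have degn d v : v != 0 -> homogeneous A d v -> d != 0.
  by move=> vn hv; apply: contra_neq vn => d0; apply: h0; rewrite -d0.
have d1n := degn _ _ y1n hy1; have d2n := degn _ _ y2n hy2.
have d12n := degn _ _ y3n hy3.
(* Equal degrees would put the nonzero vector [y3] in degree 0. *)
have d12 : d1 != d2 by apply: contraNneq d12n => ->; rewrite GammaDD.
have d13 : d1 != d1 + d2 by rewrite eq_sym -subr_eq0 addrAC subrr add0r.
have d23 : d2 != d1 + d2 by rewrite eq_sym -subr_eq0 addrK.
pose y (i : 'I_3) := [:: y1; y2; y3]`_i.
pose dd (i : 'I_3) := [:: d1; d2; d1 + d2]`_i.
have hy i : homogeneous A (dd i) (y i) by elim/ord3P: i.
pose lambda := nrm y3.
have l0 : lambda != 0 by rewrite gt_eqF // nrm_gt0.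
pose M := basis_mx y.
have bM : bracket_mx M by exact: bracket_basis_mx.
have unit1 v : v != 0 -> g 0 (unitv v) (unitv v) = 1.
  move=> vn.
  rewrite metric_scalel // gs metric_scalel // -nrm_sqr //.
  by field; rewrite gt_eqF ?nrm_gt0.
have gM v w : g 0 (v *m M) (w *m M) = standard_form lambda v w.
  apply: metric_basis_mx => //=; first exact: unit1.
  - exact: unit1.
  - by rewrite nrm_sqr.
  - exact: homogeneous_orthogonal gA hy1 hy2 d12.
  - exact: homogeneous_orthogonal gA hy1 hy3 d13.
  - exact: homogeneous_orthogonal gA hy2 hy3 d23.
have std0 v w : standard_metric lambda 0 v w = standard_form lambda v w.
  by rewrite standard_metricE !mcartan0.
have stdR := standard_riemannian l0.
have stdL := @standard_left_invariant R lambda.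
(* By [gM], a vector killed by [M] has length 0 for the positive definite standard metric. *)
have uM : M \in unitmx.
  rewrite unitmxE unitfE; apply/negP => /det0P[v vn vM].
  have [_ _ /(_ 0 _ vn) + _] := stdR.
  have g00 := metric_scalel 0 0 (0 : 'rV_3) 0 gR.
  by rewrite std0 -gM vM -[X in g 0 X](scale0r 0) g00 mul0r ltxx.
pose N := invmx M.
have bN : bracket_mx N by exact: bracket_mxV.
have uN : N \in unitmx by rewrite unitmx_inv.
have phiK : cancel (linaut N) (linaut M).
  by move=> x; rewrite linaut_comp mulVmx // linaut1.
(* [N] sends each [y i] to X_i, so the conjugated symmetries are diagonal in the basis X_i, with
   entries [chi R (dd i) c]. *)
pose D c := M *m A c *m N.
have MA c v : v *m M *m A c = (\row_i (chi R (dd i) c * v 0 i)) *m M.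
  rewrite !mul_basis_mx 2!mulmxDl -3!scalemxAl !hy !mxE !scalerA.
  by rewrite ![v 0 _ * _]mulrC.
have DE c v : v *m D c = \row_i (chi R (dd i) c * v 0 i).
  by rewrite /D 2!mulmxA MA mulmxK.
have bD c : bracket_mx (D c) by do 2 apply: bracket_mxM => //.
have uD c : D c \in unitmx by rewrite !unitmx_mul uM uA uN.
pose rho0 c := linaut (D c).
have conj c x : linaut N (rho c x) = rho0 c (linaut N x).
  by rewrite rhoE /rho0 !linaut_comp /D !mulmxA mulVmx // mul1mx.
(* Since [D c] is diagonal, membership depends only on the support of [v]: a coordinate of another
   degree is negated by some symmetry that should fix it up to the sign of [d]. *)
have componentP d v :
    component rho0 d v <-> forall i, v 0 i != 0 -> dd i = d.
  split=> [vd i|vd c].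
    apply: contraNeq => /(chi_separates R)[c dc].
    have := vd c; rewrite honeE diff_linaut0 DE => /rowP/(_ i).
    rewrite !mxE dc -/(chi R d c) mulNr => /eqP.
    by rewrite eq_sym -subr_eq0 opprK -mulr2n mulrn_eq0 /= mulf_eq0 signr_eq0.
  rewrite honeE diff_linaut0 DE; apply/rowP => i; rewrite !mxE.
  by have [->|/vd ->] := eqVneq (v 0 i) 0; rewrite ?mulr0.
have lineP d i : (forall j, (dd j == d) = (j == i)) ->
    component rho0 d = range (fun t => t *: basisX R i).
  move=> ddi; apply/seteqP; split=> v.
    move=> /componentP vd; exists (v 0 i) => //.
    apply/rowP => j; rewrite !mxE /=.
    have [->|ji] := eqVneq j i; first by rewrite mulr1.
    rewrite mulr0; apply/esym/eqP.
    by apply: contraNT ji => /vd/eqP; rewrite ddi.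
  move=> [t _ <-]; apply/componentP => j; rewrite !mxE /= => tj; apply/eqP.
  by rewrite ddi; apply: contraNT tj => /negPf ->; rewrite mulr0.
exists lambda, rho0; split=> //.
- split=> // [|c]; last first.
    split; first exact: linaut_diffeo.
    apply: pulls_back_linaut => // v w.
    rewrite !std0 !DE /standard_form !mxE.
    have chi2 i :
        chi R (dd i) c * v 0 i * (chi R (dd i) c * w 0 i) = v 0 i * w 0 i.
      by rewrite mulrACA chi_sqr mul1r.
    by rewrite !chi2.
  split.
  + by move=> c; exact: linaut_lie.
  + move=> c c'; apply/funext => x /=; rewrite /rho0 linaut_comp /D AD.
    by rewrite !mulmxA mulmxKV.
  (* Conjugation by the isomorphism [linaut N] brings an equality of new symmetries back to the
     original ones. *)
  + move=> c c' /(congr1 (fun f x => f (linaut N x))) cc'; apply: rhoI.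
    apply/funext => x; apply: (can_inj phiK).
    by rewrite !conj; exact: (congr1 (fun f => f x) cc').
  (* The fixed set itself is trivial: all three degrees are nonzero, so each logarithmic coordinate
     is negated by some symmetry. *)
  + apply: subset_trans (@connected_component_sub _ _ _) _ => x xF /=.
    have x0 i : dd i != 0 -> hlog x 0 i = 0.
      move=> /(chi_nontrivial R)[c dc].
      have := congr1 hlog (xF c); rewrite /rho0 /linaut hexpK DE => /rowP/(_ i).
      by rewrite mxE dc mulN1r => /eqP;
        rewrite eq_sym -subr_eq0 opprK -mulr2n mulrn_eq0 => /eqP.
    rewrite honeE -[x]hlogK -[RHS]hexp0; congr hexp.
    by apply: rV3P; rewrite x0 ?mxE.
  + by move=> _ -> c; rewrite honeE /rho0 linaut0.
- split.
    apply/seteqP; split=> v; last first.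
      by move=> ->; apply/componentP => i; rewrite mxE eqxx.
    move=> /componentP v0; apply/rowP => i; rewrite mxE; apply/eqP.
    apply: contraT => /v0 ddi; move: ddi d1n d2n d12n.
    by rewrite /dd; elim/ord3P: i => /= ->; rewrite eqxx.
  exists d1, d2; split=> //; apply: lineP; elim/ord3P;
    rewrite /dd /= ?eqxx // ?(negPf d12) ?(negPf d13) ?(negPf d23) //;
    by rewrite eq_sym ?(negPf d12) ?(negPf d13) ?(negPf d23).
- exists (linaut N); split; first exact: linaut_lie.
    split; first exact: linaut_diffeo.
    by apply: pulls_back_linaut => // v w; rewrite std0 -gM !mulmxKV.
  by move=> c; apply/funext => x /=; rewrite conj.
Qed.
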